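(* Let $G$ and $H$ be graphs, with adjacency matrices $A_G$ and $A_H$. There exists a bi-covering homomorphism from $G$ to $H$ if and only if there exists a subamalgamation matrix $S$, with rows indexed by $\mathcal{V}(G)$ and columns indexed by $\mathcal{V}(H)$, such that $$A_G S = S A_H \quad\text{and}\quad S^{\mathsf T} A_G = A_H S^{\mathsf T}.$$
   Context: A graph $G$ is a finite directed graph: a pair $(\mathcal{V}(G),\mathcal{E}(G))$ of a finite set of vertices and a finite set of edges, each edge having an initial and a terminal vertex (loops and multiple edges are allowed). The adjacency matrix $A_G$ is indexed by $\mathcal{V}(G)\times\mathcal{V}(G)$ and its $(I,J)$ entry is the number of edges from $I$ to $J$. A (graph) homomorphism $\Phi=(\Phi_{\mathcal V},\Phi_{\mathcal E}):G\to H$ is a pair of maps $\Phi_{\mathcal V}:\mathcal{V}(G)\to\mathcal{V}(H)$ and $\Phi_{\mathcal E}:\mathcal{E}(G)\to\mathcal{E}(H)$ respecting adjacency (an edge from $I$ to $J$ is sent to an edge from $\Phi_{\mathcal V}(I)$ to $\Phi_{\mathcal V}(J)$). $\Phi$ is right covering if for each $I\in\mathcal{V}(G)$ the restriction of $\Phi_{\mathcal E}$ to the set of edges of $G$ starting from $I$ is a bijection onto the set of edges of $H$ starting from $\Phi_{\mathcal V}(I)$. It is left covering if the same holds with ''starting from'' replaced by ''ending at''. It is bi-covering if it is both left and right covering. A subamalgamation matrix is a 0-1 matrix with exactly one $1$ in each row. $S^{\mathsf T}$ denotes the transpose of $S$. *)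

(* Defs.v *)
From mathcomp Require Import all_boot all_algebra.

Set Implicit Arguments.
Unset Strict Implicit.
Unset Printing Implicit Defensive.

Local Open Scope ring_scope.

Record digraph := Digraph {
  vertex : finType;
  edge : finType;
  initial : edge -> vertex;
  terminal : edge -> vertex
}.

(* MathComp matrices are indexed by ordinals, so a vertex I is identified with
   its rank in the enumeration of the vertex type (enum_rank / enum_val). *)
Definition adjacency (G : digraph) : 'M[nat]_#|vertex G| :=
  \matrix_(i, j) #|[set e : edge G | (initial e == enum_val i)
                                     && (terminal e == enum_val j)]|.

Record graph_hom (G H : digraph) := GraphHom {
  hom_vertex : vertex G -> vertex H;
  hom_edge : edge G -> edge H;
  hom_initial : forall e, initial (hom_edge e) = hom_vertex (initial e);
  hom_terminal : forall e, terminal (hom_edge e) = hom_vertex (terminal e)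
}.

Definition out_edges (G : digraph) (I : vertex G) : {set edge G} :=
  [set e | initial e == I].

Definition in_edges (G : digraph) (I : vertex G) : {set edge G} :=
  [set e | terminal e == I].

Definition bijection_onto (T U : finType) (f : T -> U)
    (A : {set T}) (B : {set U}) : Prop :=
  {in A &, injective f} /\ f @: A = B.

Definition right_covering (G H : digraph) (Phi : graph_hom G H) : Prop :=
  forall I : vertex G,
    bijection_onto (hom_edge Phi) (out_edges I) (out_edges (hom_vertex Phi I)).

Definition left_covering (G H : digraph) (Phi : graph_hom G H) : Prop :=
  forall I : vertex G,
    bijection_onto (hom_edge Phi) (in_edges I) (in_edges (hom_vertex Phi I)).

Definition bi_covering (G H : digraph) (Phi : graph_hom G H) : Prop :=
  left_covering Phi /\ right_covering Phi.

Definition subamalgamation (m n : nat) (S : 'M[nat]_(m, n)) : Prop :=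
  (forall i j, S i j = 0%N \/ S i j = 1%N) /\
  (forall i, exists! j, S i j = 1%N).

(* Main.v *)
Require Import Defs.
From mathcomp Require Import all_boot all_algebra.
From mathcomp Require Import perm.

(** Write phi for the vertex map encoded by S: row I of S has its unique 1 in
    column phi I.  Entry by entry, A_G S = S A_H says that a vertex I of G sends
    into the fibre of J' exactly as many edges as there are edges from phi I to
    J' in H, and S^T A_G = A_H S^T is the same statement for the reversed
    graphs ([mulmx_adjacency_fiberP], [adjacency_rev]).  A bi-covering
    homomorphism satisfies these equations because it restricts to bijections
    between the sets of edges being counted.

    Conversely, suppose that the counts agree.  Fix vertices I', J' of H joined
    by k edges; the edges of G from the fibre of I' to the fibre of J' form a
    k-regular bipartite multigraph.  By Koenig's theorem its edges can be
    coloured with k colours so that edges with a common end have different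
    colours.  Take the k edges from I' to J' as colours: the colouring is then
    the edge map of a homomorphism over phi, properness is injectivity on the
    edges leaving (or entering) a vertex, and surjectivity follows because the
    counts agree.

    All pairs (I', J') are treated at once: [koenig_edge_coloring] allows the
    palette to depend on the edge, as long as adjacent edges have the same
    palette.  It is proved by adding one edge at a time and exchanging two
    colours along a Kempe chain to free a colour at both ends of the new edge. *)

Set Implicit Arguments.
Unset Strict Implicit.
Unset Printing Implicit Defensive.

Local Open Scope ring_scope.

(** * Edge colourings of bipartite multigraphs *)

(** A bipartite multigraph is given by its edges together with two maps to its
    two classes of vertices; [z] stands for either of these maps. *)
Definition proper_at (E C : finType) (Z : eqType) (z : E -> Z)
    (D : {set E}) (c : E -> C) : Prop :=
  forall f g, f \in D -> g \in D -> z f = z g -> c f = c g -> f = g.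

(** The edges of [D] at the end of [e], together with [e] itself, are at most as
    many as the colours of [P], so those of [D] alone leave a colour unused. *)
Lemma free_color (E C : finType) (Z : eqType) (z : E -> Z) (D : {set E})
    (c : E -> C) (P : {set C}) (e : E) :
    e \notin D -> (#|[set f | z f == z e]| <= #|P|)%N ->
  exists2 a, a \in P & forall f, f \in D -> z f = z e -> c f <> a.
Proof.
move=> eD degP; pose B := c @: [set f in D | z f == z e].
have /subsetPn[a aP aB] : ~~ (P \subset B).
  apply/negP => /subset_leq_card; apply/negP; rewrite -ltnNge.
  apply: (leq_ltn_trans (leq_imset_card _ _)); apply: leq_trans degP.
  apply/proper_card/properP; split.
    by apply/subsetP=> f; rewrite !inE => /andP[].
  by exists e; rewrite !inE ?eqxx // (negPf eD).
exists a => // f fD fe cfa; case/negP: aB; apply/imsetP; exists f => //.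
by rewrite inE fD fe eqxx.
Qed.

(** Exchanging the colours [a] and [b] on a set [K] can only create a conflict
    between an edge of [K] and an edge coloured [a] or [b] outside [K]. *)
Lemma proper_at_exchange (E C : finType) (Z : eqType) (z : E -> Z)
    (D K : {set E}) (c : E -> C) (a b : C) :
    proper_at z D c ->
    (forall f, f \in K -> c f \in [set a; b]) ->
    (forall f g, f \in K -> g \in D -> z f = z g -> c g \in [set a; b] ->
       g \in K) ->
  proper_at z D (fun f => if f \in K then tperm a b (c f) else c f).
Proof.
move=> cP Kab Kz.
have mixed f g : f \in K -> g \in D -> z f = z g ->
    tperm a b (c f) = c g -> g \in K.
  move=> fK gD zfg cfg; apply: (Kz f) => //; rewrite -cfg.
  by move: (Kab f fK); rewrite !inE; case: tpermP => //; rewrite eqxx ?orbT.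
move=> f g fD gD zfg; case: ifPn => fK; case: ifPn => gK.
- by move/perm_inj; apply: cP.
- by move/(mixed f g fK gD zfg); rewrite (negPf gK).
- by move=> /esym/(mixed g f gK fD (esym zfg)); rewrite (negPf fK).
- exact: cP.
Qed.

(** One step of the search for the Kempe chain that starts at the vertex [t e]
    with colour [a] and then alternates between [b] and [a]: [a]-edges are
    entered through their [t]-end and [b]-edges through their [s]-end. *)
Definition kempe_step (E C : finType) (X Y : eqType) (s : E -> X) (t : E -> Y)
    (L : E -> {set C}) (D : {set E}) (c : E -> C) (a b : C) (e : E)
    (K : {set E}) : {set E} :=
  [set g in D | (L g == L e) &&
    ((c g == a) && ((t g == t e) ||
                    [exists h in K, (c h == b) && (t h == t g)])
     || (c g == b) && [exists h in K, (c h == a) && (s h == s g)])].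

Lemma kempe_step_mono (E C : finType) (X Y : eqType) (s : E -> X) (t : E -> Y)
    (L : E -> {set C}) (D : {set E}) (c : E -> C) (a b : C) (e : E) :
  {homo kempe_step s t L D c a b e : K K' / K \subset K'}.
Proof.
move=> K K' /subsetP KK'; apply/subsetP => g; rewrite !inE.
have sub (p : pred E) : [exists h in K, p h] -> [exists h in K', p h].
  case/existsP=> h /andP[hK ph]; apply/existsP; exists h.
  by rewrite (KK' h hK) ph.
case/andP=> -> /andP[-> /orP[]] /andP[-> /=].
  by case/orP=> [-> // | /sub ->]; rewrite orbT.
by move/sub => ->; rewrite orbT.
Qed.

(** Let [a] be free at [s e] and [b] at [t e].  The Kempe chain at [t e]
    reaches [s]-ends through [a]-edges only, hence never touches [s e];
    exchanging the two colours along it frees [a] at [t e] while keeping it free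
    at [s e], so that [e] can receive the colour [a].  Being a fixed point of
    [kempe_step] is all that the argument uses about the chain. *)
Lemma extend_coloring (E C : finType) (X Y : eqType) (s : E -> X) (t : E -> Y)
    (L : E -> {set C}) (D : {set E}) (c : E -> C) (e : E) :
    (forall f g, s f = s g -> L f = L g) ->
    (forall f g, t f = t g -> L f = L g) ->
    (#|[set f | s f == s e]| <= #|L e|)%N ->
    (#|[set f | t f == t e]| <= #|L e|)%N ->
    e \notin D -> (forall f, c f \in L f) -> proper_at s D c ->
    proper_at t D c ->
  exists c' : E -> C, [/\ forall f, c' f \in L f,
    proper_at s (e |: D) c' & proper_at t (e |: D) c'].
Proof.
move=> Ls Lt degs degt eD cL cs ct.
have [a aL afree] := free_color c eD degs.
have [b bL bfree] := free_color c eD degt.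
pose K := fixset (kempe_step s t L D c a b e).
have Kfix : kempe_step s t L D c a b e K = K.
  exact/fixsetK/kempe_step_mono.
have KD g : g \in K -> g \in D by rewrite -Kfix inE => /andP[].
have KL g : g \in K -> L g = L e by rewrite -Kfix !inE => /and3P[_ /eqP].
have Kab g : g \in K -> c g \in [set a; b].
  by rewrite -Kfix !inE => /and3P[_ _ /orP[]] /andP[-> _]; rewrite ?orbT.
have Kstart g : g \in D -> c g = a -> t g = t e -> g \in K.
  by move=> gD cg tg; rewrite -Kfix !inE gD (Lt _ _ tg) cg tg !eqxx.
have Kb g h : h \in K -> g \in D -> c h = a -> c g = b -> s h = s g -> g \in K.
  move=> hK gD ch cg shg; rewrite -Kfix !inE gD -(Ls _ _ shg) (KL _ hK) cg.
  rewrite !eqxx /=; apply/orP; right; apply/existsP; exists h.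
  by rewrite hK ch shg !eqxx.
have Ka g h : h \in K -> g \in D -> c h = b -> c g = a -> t h = t g -> g \in K.
  move=> hK gD ch cg thg; rewrite -Kfix !inE gD -(Lt _ _ thg) (KL _ hK) cg.
  rewrite !eqxx /=; apply/orP; left; apply/orP; right; apply/existsP; exists h.
  by rewrite hK ch thg !eqxx.
have Kpred g : g \in K ->
    (c g = a /\ (t g = t e \/ exists2 h, h \in K & c h = b /\ t h = t g)) \/
    (c g = b /\ exists2 h, h \in K & c h = a /\ s h = s g).
  rewrite -{1}Kfix !inE => /and3P[_ _ /orP[]] /andP[/eqP cg].
    case/orP=> [/eqP tg | /existsP[h /and3P[hK /eqP ch /eqP th]]]; left.
      by split; [|left].
    by split; [|right; exists h].
  by case/existsP=> h /and3P[hK /eqP ch /eqP sh]; right; split=> //; exists h.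
have Ks f g : f \in K -> g \in D -> s f = s g -> c g \in [set a; b] -> g \in K.
  move=> fK gD sfg; rewrite !inE => /orP[] /eqP cg.
    case: (Kpred f fK) => [[cf _] | [_ [h hK [ch sh]]]].
      by rewrite -(cs f g (KD f fK) gD sfg) // cf cg.
    by rewrite -(cs h g (KD h hK) gD) ?sh // ch cg.
  case: (Kpred f fK) => [[cf _] | [cf _]]; first exact: (Kb g f).
  by rewrite -(cs f g (KD f fK) gD sfg) // cf cg.
have Kt f g : f \in K -> g \in D -> t f = t g -> c g \in [set a; b] -> g \in K.
  move=> fK gD tfg; rewrite !inE => /orP[] /eqP cg.
    case: (Kpred f fK) => [[cf _] | [cf _]]; last exact: (Ka g f).
    by rewrite -(ct f g (KD f fK) gD tfg) // cf cg.
  case: (Kpred f fK) => [[_ [tf | [h hK [ch th]]]] | [cf _]].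
  - by case: (bfree g gD _ cg); rewrite -tfg.
  - by rewrite -(ct h g (KD h hK) gD) ?th // ch cg.
  - by rewrite -(ct f g (KD f fK) gD tfg) // cf cg.
have Kavoid g : g \in K -> s g <> s e.
  move=> gK sg; case: (Kpred g gK) => [[cg _] | [_ [h hK [ch sh]]]].
    exact: (afree g (KD g gK) sg cg).
  by apply: (afree h (KD h hK) _ ch); rewrite sh.
pose c1 f := if f \in K then tperm a b (c f) else c f.
pose c' f := if f == e then a else c1 f.
have afree_s g : g \in D -> s g = s e -> c1 g <> a.
  rewrite /c1 => gD sg; case: ifPn => [/Kavoid // | _]; exact: afree.
have afree_t g : g \in D -> t g = t e -> c1 g <> a.
  rewrite /c1 => gD tg; case: ifPn => [_ | gK cg].
    by rewrite -[X in _ = X](tpermR a b) => /perm_inj; apply: bfree.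
  by rewrite (Kstart g) in gK.
have extend (Z : eqType) (z : E -> Z) : proper_at z D c1 ->
    (forall g, g \in D -> z g = z e -> c1 g <> a) -> proper_at z (e |: D) c'.
  move=> c1z azfree f g; rewrite /c' !inE.
  case: eqVneq => [-> _ | _ /= fD]; case: eqVneq => [-> _ | _ /= gD] //.
  - by move=> zg /esym ca; case: (azfree g gD).
  - by move=> zf ca; case: (azfree f fD).
  - exact: c1z.
exists c'; split.
- move=> f; rewrite /c' /c1; case: eqVneq => [-> // | _].
  case: ifPn => [fK | _]; last exact: cL.
  by case: tpermP => *; rewrite ?cL ?(KL f fK).
- by apply: extend => //; apply: proper_at_exchange.
- by apply: extend => //; apply: proper_at_exchange.
Qed.

(** Koenig's edge colouring theorem.  A constant palette [L] gives its usual
    form: a bipartite multigraph of maximal degree k is k-edge-colourable. *)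
Lemma koenig_edge_coloring (E C : finType) (X Y : eqType) (s : E -> X)
    (t : E -> Y) (L : E -> {set C}) :
    (forall f g, s f = s g -> L f = L g) ->
    (forall f g, t f = t g -> L f = L g) ->
    (forall e, #|[set f | s f == s e]| <= #|L e|)%N ->
    (forall e, #|[set f | t f == t e]| <= #|L e|)%N ->
  exists c : E -> C, [/\ forall e, c e \in L e,
    forall f g, s f = s g -> c f = c g -> f = g &
    forall f g, t f = t g -> c f = c g -> f = g].
Proof.
move=> Ls Lt degs degt.
have color r : uniq r -> exists c : E -> C, [/\ forall e, c e \in L e,
    proper_at s [set e in r] c & proper_at t [set e in r] c].
  elim: r => [_ | e r IHr /= /andP[er /IHr[c [cL cs ct]]]].
    have: forall e, exists a, a \in L e.
      move=> e; apply/set0Pn; rewrite -card_gt0; apply: leq_trans (degs e).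
      by rewrite card_gt0; apply/set0Pn; exists e; rewrite inE.
    by case/fin_all_exists=> c cL; exists c; split=> // f g; rewrite inE.
  rewrite set_cons; apply: (@extend_coloring _ _ _ _ s t L _ c e) => //.
  by rewrite inE.
have [c [cL cs ct]] := color (enum E) (enum_uniq E).
by exists c; split=> // f g; [apply: cs | apply: ct]; rewrite inE mem_enum.
Qed.

(** * The matrix equations as counts of edges *)

Definition rev_digraph (G : digraph) : digraph :=
  Digraph (@terminal G) (@initial G).

Lemma adjacency_rev (G : digraph) : adjacency (rev_digraph G) = (adjacency G)^T.
Proof.
by apply/matrixP=> i j; rewrite !mxE; apply: eq_card => e; rewrite !inE andbC.
Qed.

Definition fiber_mx (V W : finType) (phi : V -> W) : 'M[nat]_(#|V|, #|W|) :=
  \matrix_(i, j) nat_of_bool (phi (enum_val i) == enum_val j).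

Lemma subamalgamation_fiber_mx (V W : finType) (phi : V -> W) :
  subamalgamation (fiber_mx phi).
Proof.
split=> [i j | i]; first by rewrite mxE; case: eqP; [right | left].
exists (enum_rank (phi (enum_val i))); split=> [|j].
  by rewrite mxE enum_rankK eqxx.
by rewrite mxE; case: eqP => // ->; rewrite enum_valK.
Qed.

Lemma subamalgamationP (V W : finType) (S : 'M[nat]_(#|V|, #|W|)) :
  subamalgamation S -> exists phi : V -> W, S = fiber_mx phi.
Proof.
case=> S01 S1; have [f fP] := fin_all_exists S1.
exists (fun v => enum_val (f (enum_rank v))); apply/matrixP=> i j.
rewrite mxE enum_valK (inj_eq enum_val_inj); have [Sf Su] := fP i.
case: eqVneq => [<- // | fj]; case: (S01 i j) => // Sij.
by rewrite (Su j Sij) eqxx in fj.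
Qed.

(** For [phi] the vertex map of a homomorphism, this is the numerical trace of
    right covering: it compares the numbers of edges on both sides for every
    terminal vertex in [H]. *)
Definition fiber_balanced (G H : digraph) (phi : vertex G -> vertex H) : Prop :=
  forall I J, #|[set e : edge G | (initial e == I) && (phi (terminal e) == J)]|
    = #|[set h : edge H | (initial h == phi I) && (terminal h == J)]|.

Lemma mulmx_adjacency_fiberP (G H : digraph) (phi : vertex G -> vertex H) :
  adjacency G *m fiber_mx phi = fiber_mx phi *m adjacency H <->
  fiber_balanced phi.
Proof.
have lhs i j : (adjacency G *m fiber_mx phi) i j =
    #|[set e : edge G | (initial e == enum_val i)
                        && (phi (terminal e) == enum_val j)]|.
  (* The edges counted on the right are sorted by their terminal vertex. *)
  rewrite mxE -sum1_card.
  rewrite (partition_big (fun e => enum_rank (terminal e)) xpredT) //=.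
  apply: eq_bigr => k _; rewrite !mxE.
  rewrite (eq_bigl (fun e => [&& initial e == enum_val i, terminal e == enum_val k
     & phi (enum_val k) == enum_val j])); last first.
    move=> e; rewrite inE (can2_eq enum_rankK enum_valK).
    by case: (terminal e =P enum_val k) => [-> | _]; rewrite ?andbT ?andbF.
  case: (_ == enum_val j) => /=; last first.
    by rewrite big_pred0 ?GRing.mulr0 // => e; rewrite !andbF.
  rewrite GRing.mulr1 -sum1_card; apply: eq_bigl => e.
  by rewrite inE andbT.
have rhs i j : (fiber_mx phi *m adjacency H) i j =
    #|[set h : edge H | (initial h == phi (enum_val i))
                        && (terminal h == enum_val j)]|.
  rewrite mxE (bigD1 (enum_rank (phi (enum_val i)))) //= big1 => [|k kI].
    by rewrite !mxE enum_rankK eqxx GRing.mul1r GRing.addr0.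
  rewrite !mxE; case: (phi _ =P _) kI => [-> | _ _].
    by rewrite enum_valK eqxx.
  by rewrite GRing.mul0r.
split=> [eqAS I J | bal].
  have := congr1 (fun M : 'M__ => M (enum_rank I) (enum_rank J)) eqAS.
  by rewrite lhs rhs !enum_rankK.
by apply/matrixP=> i j; rewrite lhs rhs bal.
Qed.

Lemma mulmx_adjacency_rev_fiberP (G H : digraph) (phi : vertex G -> vertex H) :
  (fiber_mx phi)^T *m adjacency G = adjacency H *m (fiber_mx phi)^T <->
  fiber_balanced (phi : vertex (rev_digraph G) -> vertex (rev_digraph H)).
Proof.
have := @mulmx_adjacency_fiberP (rev_digraph G) (rev_digraph H) phi.
rewrite !adjacency_rev /= => balP; split=> [eqS | bal].
  by apply/balP/trmx_inj; rewrite !trmx_mul !trmxK.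
by apply: trmx_inj; rewrite !trmx_mul !trmxK; apply/balP.
Qed.

(** * Coverings and counts *)

Definition rev_hom (G H : digraph) (Phi : graph_hom G H) :
    graph_hom (rev_digraph G) (rev_digraph H) :=
  @GraphHom (rev_digraph G) (rev_digraph H) (hom_vertex Phi) (hom_edge Phi)
    (hom_terminal Phi) (hom_initial Phi).

Lemma right_covering_balanced (G H : digraph) (Phi : graph_hom G H) :
  right_covering Phi -> fiber_balanced (hom_vertex Phi).
Proof.
move=> cov I J; have [inj img] := cov I.
rewrite -(card_in_imset (f := hom_edge Phi)); last first.
  move=> e f; rewrite !inE => /andP[eI _] /andP[fI _].
  by apply: inj; rewrite inE.
apply: eq_card => h; rewrite inE; apply/imsetP/andP.
  case=> e; rewrite inE => /andP[/eqP eI /eqP eJ] ->.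
  by rewrite hom_initial hom_terminal eI eJ.
case=> hI hJ; have: h \in out_edges (hom_vertex Phi I) by rewrite inE.
rewrite -img => /imsetP[e]; rewrite inE => eI def_h; exists e => //.
by rewrite inE eI -hom_terminal -def_h.
Qed.

(** Injectivity has to be supposed only for edges with equal images of their
    terminal vertices, since the homomorphism separates the others; equality of
    the counts then gives surjectivity. *)
Lemma balanced_right_covering (G H : digraph) (Phi : graph_hom G H) :
    fiber_balanced (hom_vertex Phi) ->
    (forall e f, initial e = initial f ->
       hom_vertex Phi (terminal e) = hom_vertex Phi (terminal f) ->
       hom_edge Phi e = hom_edge Phi f -> e = f) ->
  right_covering Phi.
Proof.
move=> bal inj I.
have injI : {in out_edges I &, injective (hom_edge Phi)}.
  move=> e f; rewrite !inE => /eqP eI /eqP fI ef.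
  by apply: inj; rewrite ?eI ?fI // -!hom_terminal ef.
split=> //; apply/setP=> h; apply/imsetP/idP => [[e] | ].
  by rewrite !inE => /eqP <- ->; rewrite hom_initial.
rewrite inE => hI.
pose A := [set e : edge G | (initial e == I)
                            && (hom_vertex Phi (terminal e) == terminal h)].
pose B := [set k : edge H | (initial k == hom_vertex Phi I)
                            && (terminal k == terminal h)].
have /eqP AB : hom_edge Phi @: A == B.
  rewrite eqEcard card_in_imset ?bal ?leqnn ?andbT; last first.
    move=> e f; rewrite !inE => /andP[eI _] /andP[fI _].
    by apply: injI; rewrite inE.
  apply/subsetP=> _ /imsetP[e + ->]; rewrite !inE => /andP[/eqP <- /eqP <-].
  by rewrite hom_initial hom_terminal !eqxx.
have: h \in B by rewrite inE hI eqxx.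
by rewrite -AB => /imsetP[e]; rewrite inE => /andP[eI _] ->; exists e; rewrite ?inE.
Qed.

(** The colours of an edge [e] of [G] are the possible images of [e] in [H].  The
    two ends of [e] are refined by the image of the opposite vertex, so that
    edges become adjacent only if they have the same possible images. *)
Lemma balanced_bi_covering (G H : digraph) (phi : vertex G -> vertex H) :
    fiber_balanced phi ->
    fiber_balanced (phi : vertex (rev_digraph G) -> vertex (rev_digraph H)) ->
  exists Phi : graph_hom G H, bi_covering Phi.
Proof.
move=> balr ball.
pose s (e : edge G) := (initial e, phi (terminal e)).
pose t (e : edge G) := (terminal e, phi (initial e)).
pose L (e : edge G) := [set h : edge H | (initial h == phi (initial e))
                                         && (terminal h == phi (terminal e))].
have [|||| c [cL cs ct]] := @koenig_edge_coloring _ _ _ _ s t L.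
- by move=> f g [sfg tfg]; rewrite /L sfg tfg.
- by move=> f g [tfg sfg]; rewrite /L sfg tfg.
- move=> e; rewrite /L -balr; apply/eq_leq/eq_card => f.
  by rewrite !inE xpair_eqE.
- move=> e; have {}ball := ball (terminal e) (phi (initial e)).
  apply: eq_leq; transitivity #|[set f : edge G | (terminal f == terminal e)
                                   && (phi (initial f) == phi (initial e))]|.
    by apply: eq_card => f; rewrite !inE xpair_eqE.
  by rewrite ball; apply: eq_card => h; rewrite !inE andbC.
have ci e : initial (c e) = phi (initial e).
  by have:= cL e; rewrite inE => /andP[/eqP].
have ce e : terminal (c e) = phi (terminal e).
  by have:= cL e; rewrite inE => /andP[_ /eqP].
exists (GraphHom ci ce); split.
  apply: (@balanced_right_covering _ _ (rev_hom (GraphHom ci ce))) => // e f.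
  by move=> /= te se; apply: ct; rewrite /t te se.
apply: balanced_right_covering => // e f /= se te.
by apply: cs; rewrite /s se te.
Qed.

Theorem theorem3p1 (G H : digraph) :
  (exists Phi : graph_hom G H, bi_covering Phi) <->
  (exists S : 'M[nat]_(#|vertex G|, #|vertex H|),
     [/\ subamalgamation S,
         adjacency G *m S = S *m adjacency H &
         S^T *m adjacency G = adjacency H *m S^T]).
Proof.
split=> [[Phi [covl covr]] | [S [/subamalgamationP[phi ->]]]].
  exists (fiber_mx (hom_vertex Phi)); split.
  - exact: subamalgamation_fiber_mx.
  - exact/mulmx_adjacency_fiberP/right_covering_balanced.
  - apply/mulmx_adjacency_rev_fiberP.
    exact: (@right_covering_balanced _ _ (rev_hom Phi)).
move=> /mulmx_adjacency_fiberP balr /mulmx_adjacency_rev_fiberP ball.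
exact: balanced_bi_covering balr ball.
Qed.
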